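(* Let $(X,\sigma)$ with metric $d$ be the subshift described in the context, and let $\varepsilon\in(0,1)$. Then $$\overline{D}_{\mathrm{int}}(X,\varepsilon,d)=\underline{D}_{\mathrm{int}}(X,\varepsilon,d)=1>0=\overline{D}_{\mathrm{ext}}(X,\varepsilon,d)=\underline{D}_{\mathrm{ext}}(X,\varepsilon,d).$$ The same conclusion holds for both the preimage and asymptotic counterparts, that is, $$\overline{D}^{\mathrm{pre}}_{\mathrm{int}}(X,\varepsilon,d)=\underline{D}^{\mathrm{pre}}_{\mathrm{int}}(X,\varepsilon,d)=1>0=\overline{D}^{\mathrm{pre}}_{\mathrm{ext}}(X,\varepsilon,d)=\underline{D}^{\mathrm{pre}}_{\mathrm{ext}}(X,\varepsilon,d),$$ $$\overline{D}^{\mathrm{as}}_{\mathrm{int}}(X,d)=\underline{D}^{\mathrm{as}}_{\mathrm{int}}(X,d)=1>0=\overline{D}^{\mathrm{as}}_{\mathrm{ext}}(X,d)=\underline{D}^{\mathrm{as}}_{\mathrm{ext}}(X,d).$$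
   Context: **Quantities for a $\mathbb{Z}$-action.** Fix $F_n=\{0,1,\dots,n-1\}$, $n\in\mathbb N$. Let $T:W\to W$ be a homeomorphism of a compact metric space $(W,d)$. Put $d_{F_n}(w,z)=\max_{0\le k<n}d(T^kw,T^kz)$; for nonempty $K\subset W$, $s_{F_n}(K,\delta,d)$ is the maximal cardinality of a set $H\subset K$ with $d_{F_n}(w,z)>\delta$ for all distinct $w,z\in H$; $h_{\mathrm{top}}(K,\delta,\{F_n\}_{n\in\mathbb N},d)=\limsup_{n\to\infty}\frac1n\log s_{F_n}(K,\delta,d)$. For $\varepsilon>0$, $w\in W$: - $\Gamma_\varepsilon^{\{F_m\}_{m\in\mathbb N}}(w)=\{z\in W:d(T^kz,T^kw)\le\varepsilon\ \forall k\ge0\}$; - $\Gamma_{\mathrm{as}}(w)=\{z\in W:\lim_{n\to\infty}d(T^nz,T^nw)=0\}$; - $\Phi_\varepsilon(w,\delta,d)=\limsup_{n\to\infty}\frac1n\log s_{F_n}(T^{-n}\Gamma_\varepsilon^{\{F_m\}_{m\in\mathbb N}}(w),\delta,d)$. For a function $q(w,\delta)$ consider the four numbers $\limsup_{\delta\to0}\sup_{w}\frac{q(w,\delta)}{\log(1/\delta)}$, $\liminf_{\delta\to0}\sup_w\frac{q(w,\delta)}{\log(1/\delta)}$, $\sup_w\limsup_{\delta\to0}\frac{q(w,\delta)}{\log(1/\delta)}$, $\sup_w\liminf_{\delta\to0}\frac{q(w,\delta)}{\log(1/\delta)}$. For $q(w,\delta)=h_{\mathrm{top}}(\Gamma_\varepsilon^{\{F_m\}}(w),\delta,\{F_n\},d)$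 these are denoted, in this order, $\overline{D}_{\mathrm{int}}(W,\varepsilon,d)$, $\underline{D}_{\mathrm{int}}(W,\varepsilon,d)$, $\overline{D}_{\mathrm{ext}}(W,\varepsilon,d)$, $\underline{D}_{\mathrm{ext}}(W,\varepsilon,d)$. For $q=\Phi_\varepsilon(w,\delta,d)$ they carry the superscript $\mathrm{pre}$: $\overline{D}^{\mathrm{pre}}_{\mathrm{int}}(W,\varepsilon,d)$, etc. (the preimage counterparts). For $q(w,\delta)=h_{\mathrm{top}}(\Gamma_{\mathrm{as}}(w),\delta,\{F_n\},d)$ they carry the superscript $\mathrm{as}$: $\overline{D}^{\mathrm{as}}_{\mathrm{int}}(W,d)$, etc. (the asymptotic counterparts). **The system $X$.** $\sigma$ is the left shift on $[0,2]^{\mathbb Z}$ and $d(x,y)=\sup_{n\in\mathbb Z}\frac{|x_n-y_n|}{2^{|n|}}$. Let $X^{(0)}$ consist of $0^{\mathbb Z}$ and all $x\in\{0,2\}^{\mathbb Z}$ with exactly one coordinate equal to $2$. For $n\in\mathbb N=\{1,2,\dots\}$ let $G_n=\{2^{-n}+k\,2^{-n^2}:k=1,\dots,2^{n^2-n}\}$. Fix a strictly increasing sequence $\{P_m\}_{m\in\mathbb N}$ in $\mathbb N$, let $X_n=\{x\in(G_n\cup\{2\})^{\mathbb Z}: x_i=2 \text{ if } i\equiv0\ (\mathrm{mod}\ P_n),\ x_i\in G_n\text{ otherwise}\}$, $X^{(n)}=\bigcup_{i\in\mathbb Z}\sigma^iX_n$, and $X=\bigcup_{n\ge0}X^{(n)}$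 (a closed shift-invariant subset of $[0,2]^{\mathbb Z}$). *)

(* Defs.v *)
From HB Require Import structures.
From mathcomp Require Import all_boot all_order all_algebra finmap.
From mathcomp Require Import all_classical all_reals all_analysis.

Set Implicit Arguments.
Unset Strict Implicit.
Unset Printing Implicit Defensive.

Import Order.TTheory GRing.Theory Num.Theory.
Import numFieldNormedType.Exports.

Local Open Scope classical_set_scope.
Local Open Scope ring_scope.

(* The compact metric space (W, d) is given as a subset W of an ambient type U,
   with d and T defined on U; only their restrictions to W matter below. *)
Section System.
Context {R : realType} {U : choiceType}.
Variables (W : set U) (T : U -> U) (d : U -> U -> R).

(* 0 is a neutral starting value because d is nonnegative on W *)
Definition bowen_dist (n : nat) (w z : U) : R :=
  \big[Num.max/0]_(k < n) d (iter k T w) (iter k T z).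

Definition bowen_separated (n : nat) (delta : R) (H : {fset U}) : Prop :=
  forall w z, w \in H -> z \in H -> w != z -> delta < bowen_dist n w z.

(* Maximal cardinality of a separated subset of K: the supremum is a maximum
   when W is compact, and would be +oo if it were not attained. *)
Definition sep_num (n : nat) (K : set U) (delta : R) : \bar R :=
  ereal_sup [set (#|` H|%:R)%:E |
    H in [set H : {fset U} | [set` H] `<=` K /\ bowen_separated n delta H]].

Definition htop (K : set U) (delta : R) : \bar R :=
  limn_esup (fun n => ((n%:R)^-1)%:E * lne (sep_num n K delta))%E.

Definition Gamma_eps (eps : R) (w : U) : set U :=
  [set z | W z /\ forall k : nat, d (iter k T z) (iter k T w) <= eps].

Definition Gamma_as (w : U) : set U :=
  [set z | W z /\ (fun n : nat => d (iter n T z) (iter n T w)) @ \oo --> (0 : R)].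

(* T^{-n} K is the preimage of K under T^n, taken inside W *)
Definition preim_iter (n : nat) (K : set U) : set U :=
  W `&` (iter n T @^-1` K).

Definition q_eps (eps : R) (w : U) (delta : R) : \bar R :=
  htop (Gamma_eps eps w) delta.

Definition q_pre (eps : R) (w : U) (delta : R) : \bar R :=
  limn_esup (fun n => ((n%:R)^-1)%:E *
    lne (sep_num n (preim_iter n (Gamma_eps eps w)) delta))%E.

Definition q_as (w : U) (delta : R) : \bar R :=
  htop (Gamma_as w) delta.

Section FourNumbers.
Variable q : U -> R -> \bar R.

Definition log_ratio (w : U) (delta : R) : \bar R :=
  (q w delta * ((ln delta^-1)^-1)%:E)%E.

Definition upper_int : \bar R :=
  limf_esup (fun delta : R => ereal_sup [set log_ratio w delta | w in W]) 0^'+.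

Definition lower_int : \bar R :=
  limf_einf (fun delta : R => ereal_sup [set log_ratio w delta | w in W]) 0^'+.

Definition upper_ext : \bar R :=
  ereal_sup [set limf_esup (log_ratio w) 0^'+ | w in W].

Definition lower_ext : \bar R :=
  ereal_sup [set limf_einf (log_ratio w) 0^'+ | w in W].

End FourNumbers.

Definition Dint_upper (eps : R) := upper_int (q_eps eps).
Definition Dint_lower (eps : R) := lower_int (q_eps eps).
Definition Dext_upper (eps : R) := upper_ext (q_eps eps).
Definition Dext_lower (eps : R) := lower_ext (q_eps eps).

Definition Dint_pre_upper (eps : R) := upper_int (q_pre eps).
Definition Dint_pre_lower (eps : R) := lower_int (q_pre eps).
Definition Dext_pre_upper (eps : R) := upper_ext (q_pre eps).
Definition Dext_pre_lower (eps : R) := lower_ext (q_pre eps).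

Definition Dint_as_upper := upper_int q_as.
Definition Dint_as_lower := lower_int q_as.
Definition Dext_as_upper := upper_ext q_as.
Definition Dext_as_lower := lower_ext q_as.

End System.

Section Example.
Variable R : realType.

Definition shift_by (k : int) (x : int -> R) : int -> R := fun i => x (i + k).

Definition left_shift : (int -> R) -> (int -> R) := shift_by 1.

(* On [0,2]^Z the set of quotients is bounded, so that [sup] is the supremum. *)
Definition dist_shift (x y : int -> R) : R :=
  sup [set `|x n - y n| / 2 ^+ absz n | n in [set: int]].

Definition X0 : set (int -> R) :=
  [set x | x = (fun=> 0) \/
    ((forall i, x i = 0 \/ x i = 2) /\ exists! i, x i = 2)].

Definition G (n : nat) : set R :=
  [set x | exists2 k : nat, (1 <= k <= 2 ^ (n ^ 2 - n))%N &
    x = 2 ^- n + k%:R * 2 ^- (n ^ 2)%N].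

Definition Xn (P : nat -> nat) (n : nat) : set (int -> R) :=
  [set x | forall i : int,
    if (Posz (P n) %| i)%Z then x i = 2 else G n (x i)].

Definition Xlevel (P : nat -> nat) (n : nat) : set (int -> R) :=
  if n is 0 then X0 else \bigcup_(i in [set: int]) (shift_by i @` Xn P n).

Definition X (P : nat -> nat) : set (int -> R) :=
  \bigcup_(n in [set: nat]) Xlevel P n.

End Example.

(* Main.v *)
(* The upper bounds are covering arguments. On orbit segments of length n a point
   of [0,2]^Z is determined up to delta by the cells, in a partition of [0,2] into
   O(1/delta) pieces, of its coordinates in a window of length n + O(1); so every
   growth rate is at most ln (1/delta) + O(1). For a fixed w all sets involved
   stay in the level X^(m) of w, because from some time on the positions of the
   symbol 2 are prescribed; as X^(m) has a finite alphabet, the growth rate is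
   bounded uniformly in delta and the external quantities vanish.
   For the lower bounds, when 2^-((n+1)^2) <= delta < 2^-(n^2) the coordinates of
   points of X_n at positions not divisible by P_n can be chosen freely among
   2^(n^2-n) values that are 2^-(n^2)-separated, giving growth rate at least
   (1 - 1/P_n) (n^2 - n) ln 2, while ln (1/delta) <= (n+1)^2 ln 2. *)

Require Import Defs.
From mathcomp Require Import all_boot all_order all_algebra finmap.
From mathcomp Require Import all_classical all_reals all_analysis.
From mathcomp Require Import ring lra zify.

Set Implicit Arguments.
Unset Strict Implicit.
Unset Printing Implicit Defensive.

Import Order.TTheory GRing.Theory Num.Theory.
Import numFieldNormedType.Exports.
Local Open Scope classical_set_scope.
Local Open Scope ring_scope.

(** * Limits superior and inferior *)

Lemma limf_esup_le (T : choiceType) (Y : filteredType T) (R : realType)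
    (f : Y -> \bar R) (F : set_system Y) (c : \bar R) :
  F [set x | f x <= c]%E -> (limf_esup f F <= c)%E.
Proof.
move=> Fc; apply: ge_ereal_inf; exists (ereal_sup (f @` [set x | f x <= c]%E)).
  by exists [set x | f x <= c]%E.
by apply: ge_ereal_sup => _ [x /= fxc <-].
Qed.

Lemma limf_esup_ge (T : choiceType) (Y : filteredType T) (R : realType)
    (f : Y -> \bar R) (F : set_system Y) (c : \bar R) :
  (forall V, F V -> exists2 x, V x & (c <= f x)%E) -> (c <= limf_esup f F)%E.
Proof.
move=> Fc; apply: le_ereal_inf_tmp => _ [V FV <-].
have [x Vx cfx] := Fc V FV.
by apply: le_ereal_sup_tmp; exists (f x) => //; exists x.
Qed.

Lemma limf_einf_ge (T : choiceType) (Y : filteredType T) (R : realType)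
    (f : Y -> \bar R) (F : set_system Y) (c : \bar R) :
  F [set x | c <= f x]%E -> (c <= limf_einf f F)%E.
Proof.
move=> Fc; rewrite /limf_einf leeNr; apply: limf_esup_le.
by rewrite /= (_ : [set x | _] = [set x | c <= f x]%E)//; apply/seteqP; split => x /=;
  rewrite leeN2.
Qed.

(** Any two members of a proper filter meet, and the value of [f] at a common point lies above the
    infimum over one and below the supremum over the other. *)
Lemma limf_einf_le_esup (T : choiceType) (Y : filteredType T) (R : realType)
    (f : Y -> \bar R) (F : set_system Y) :
  ProperFilter F -> (limf_einf f F <= limf_esup f F)%E.
Proof.
move=> FF; rewrite limf_einfE; apply: ge_ereal_sup => _ [V FV <-].
apply: limf_esup_ge => V' FV'; have [x [Vx V'x]] := filter_ex (filterI FV FV').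
by exists x => //; apply: ereal_inf_lbound; exists x.
Qed.

(** In the lower bound [1 - e] the witness may vary with [delta], because the internal numbers take
    the supremum over [W] first; in the last two bounds the range of [delta] may depend on [w]. This
    order of quantifiers separates the internal from the external values. *)
Lemma four_numbers_eq (R : realType) (U : choiceType) (W : set U)
    (q : U -> R -> \bar R) :
  W !=set0 ->
  (forall e : R, 0 < e -> \forall delta \near 0^'+,
     forall w, W w -> (log_ratio q w delta <= (1 + e)%:E)%E) ->
  (forall e : R, 0 < e -> \forall delta \near 0^'+,
     exists2 w, W w & ((1 - e)%:E <= log_ratio q w delta)%E) ->
  (forall w, W w -> forall e : R, 0 < e ->
     \forall delta \near 0^'+, (log_ratio q w delta <= e%:E)%E) ->
  (forall w, W w -> \forall delta \near 0^'+, (0 <= log_ratio q w delta)%E) ->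
  [/\ upper_int W q = 1%E, lower_int W q = 1%E,
      upper_ext W q = 0%E & lower_ext W q = 0%E].
Proof.
move=> [w0 Ww0] intle intge extle extge.
have upper_int_le : (upper_int W q <= 1)%E.
  apply/lee_addgt0Pr => e e0; apply: limf_esup_le.
  apply: filterS (intle e e0) => delta H /=.
  by apply: ge_ereal_sup => _ [w Ww <-]; rewrite -EFinD; exact: H.
have lower_int_ge : (1 <= lower_int W q)%E.
  apply/lee_subgt0Pr => e e0; apply: limf_einf_ge.
  apply: filterS (intge e e0) => delta [w Ww H] /=.
  by apply: le_ereal_sup_tmp; exists (log_ratio q w delta) => //; exists w.
have int_le : (lower_int W q <= upper_int W q)%E by exact: limf_einf_le_esup.
have upper_ext_le : (upper_ext W q <= 0)%E.
  apply: ge_ereal_sup => _ [w Ww <-].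
  apply/lee_addgt0Pr => e e0; apply: limf_esup_le.
  by rewrite add0e; exact: extle.
have lower_ext_ge : (0 <= lower_ext W q)%E.
  apply: le_ereal_sup_tmp; eexists; first by exists w0.
  exact: limf_einf_ge (extge _ Ww0).
have ext_le : (lower_ext W q <= upper_ext W q)%E.
  apply: ge_ereal_sup => _ [w Ww <-]; apply: le_ereal_sup_tmp.
  by eexists; [exists w; [exact: Ww | reflexivity] | exact: limf_einf_le_esup].
split; apply/eqP; rewrite eq_le.
- by rewrite upper_int_le (le_trans lower_int_ge).
- by rewrite lower_int_ge andbT (le_trans int_le).
- by rewrite upper_ext_le (le_trans lower_ext_ge).
- by rewrite lower_ext_ge andbT (le_trans ext_le).
Qed.

(** * Separated sets and growth rates *)

Section SeparatedSets.
Variables (R : realType) (U : choiceType) (T : U -> U) (d : U -> U -> R).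

Lemma bowen_dist_ge (n k : nat) (w z : U) :
  (k < n)%N -> d (iter k T w) (iter k T z) <= bowen_dist T d n w z.
Proof. by move=> kn; apply: (le_bigmax _ _ (Ordinal kn)). Qed.

Lemma bowen_dist_le (n : nat) (w z : U) (c : R) : 0 <= c ->
  (forall k, (k < n)%N -> d (iter k T w) (iter k T z) <= c) ->
  bowen_dist T d n w z <= c.
Proof. by move=> c0 H; apply: bigmax_le => // k _; exact: H. Qed.

Lemma sep_num_ge (n : nat) (K : set U) (delta : R) (H : {fset U}) :
  [set` H] `<=` K -> bowen_separated T d n delta H ->
  ((#|` H|%fset%:R)%:E <= sep_num T d n K delta)%E.
Proof. by move=> HK sepH; apply: ereal_sup_ubound; exists H. Qed.

Lemma sep_num_ge1 (n : nat) (K : set U) (delta : R) :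
  K !=set0 -> (1 <= sep_num T d n K delta)%E.
Proof.
move=> [w Kw]; have := @sep_num_ge n K delta [fset w]%fset.
rewrite cardfs1; apply; first by move=> z /=; rewrite inE => /eqP ->.
by move=> u v; rewrite !inE => /eqP -> /eqP ->; rewrite eqxx.
Qed.

(** Pigeonhole: [f] is injective on a separated set, since two of its points with the same code
    would be too close. *)
Lemma sep_num_le_card (F : finType) (f : U -> F) (n : nat) (K : set U)
    (delta : R) :
  (forall w z, K w -> K z -> f w = f z -> bowen_dist T d n w z <= delta) ->
  (sep_num T d n K delta <= (#|F|%:R)%:E)%E.
Proof.
move=> Kf; apply: ge_ereal_sup => _ [H [HK sepH] <-].
rewrite lee_fin ler_nat -(size_map f) cardE; apply: uniq_leq_size.
  rewrite map_inj_in_uniq ?fset_uniq// => w z Hw Hz fwz.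
  apply/eqP; case: eqVneq => // wz; exfalso.
  have := sepH w z Hw Hz wz; rewrite ltNge => /negP; apply.
  by apply: Kf => //; exact: HK.
by move=> x _; rewrite mem_enum.
Qed.

Lemma growth_ge0 (K : nat -> set U) (delta : R) :
  (forall n, K n !=set0) ->
  (0 <= limn_esup (fun n => ((n%:R)^-1)%:E * lne (sep_num T d n (K n) delta)))%E.
Proof.
move=> K0; apply: limf_esup_ge0 => [[n _] /(_ n (leqnn n))//|n].
by apply: mule_ge0; [rewrite lee_fin invr_ge0|rewrite lne_ge0; exact: sep_num_ge1].
Qed.

(** The surplus exponent [L] contributes only [L * ln M.+1 / n], which tends to 0. *)
Lemma growth_le (K : nat -> set U) (delta : R) (M L : nat) :
  (forall n, (sep_num T d n (K n) delta <= ((M.+1 ^ (n + L))%:R)%:E)%E) ->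
  (limn_esup (fun n => ((n%:R)^-1)%:E * lne (sep_num T d n (K n) delta))
     <= (ln M.+1%:R)%:E)%E.
Proof.
move=> sepK; apply/lee_addgt0Pr => e e0; apply: limf_esup_le.
pose l : R := ln M.+1%:R.
have l0 : 0 <= l by rewrite ln_ge0// ler1n.
(* From this index on, [L * l / n] is at most [e]. *)
exists (Num.trunc (L%:R * l / e)).+1 => // n /= nL.
have n0 : 0 < n%:R :> R by rewrite ltr0n (leq_trans _ nL).
have sep0 : (0 <= sep_num T d n (K n) delta)%E.
  have := @sep_num_ge n (K n) delta fset0; rewrite cardfs0; apply=> //.
have -> : (ln M.+1%:R)%:E = l%:E by [].
apply: (@le_trans _ _ ((n%:R^-1)%:E * (l *+ (n + L))%:E)%E).
  apply: lee_wpmul2l; first by rewrite lee_fin invr_ge0 ltW.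
  rewrite /l -lnXn ?ltr0n// -natrX -lne_EFin ?ltr0n ?expn_gt0//.
  by rewrite lee_lne ?in_itv/= ?leey ?andbT// lee_fin.
have -> : l *+ (n + L) = n%:R * l + L%:R * l by rewrite mulrnDr !mulr_natl.
rewrite -EFinM -EFinD lee_fin mulrDr mulrA mulVf ?gt_eqF// mul1r lerD2l.
rewrite ler_pdivrMl// -ler_pdivrMr//.
have /truncn_itv/andP[_ /ltW h] : 0 <= L%:R * l / e by rewrite !mulr_ge0 ?invr_ge0// ltW.
by apply: le_trans h _; rewrite ler_nat.
Qed.

(** A limsup is bounded below along a subsequence, here the multiples of [p]: at time [p * t] the
    lower bound normalizes to exactly [q / p * ln a]. *)
Lemma growth_ge (K : nat -> set U) (delta : R) (a p q : nat) :
  (0 < a)%N -> (0 < p)%N ->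
  (forall t, ((a ^ (q * t))%:R%:E <= sep_num T d (p * t) (K (p * t)%N) delta)%E) ->
  ((q%:R / p%:R * ln a%:R)%:E <=
   limn_esup (fun n => ((n%:R)^-1)%:E * lne (sep_num T d n (K n) delta)))%E.
Proof.
move=> a0 p0 sepK; apply: limf_esup_ge => V [m _ mV].
have t0 : 0 < m.+1%:R :> R by rewrite ltr0n.
exists (p * m.+1)%N; first by apply: mV => /=; rewrite (leq_trans (leqnSn m))// leq_pmull.
apply: (@le_trans _ _ (((p * m.+1)%:R^-1)%:E * (lne (a ^ (q * m.+1))%:R%:E)))%E.
  rewrite lne_EFin ?ltr0n ?expn_gt0 ?a0// -EFinM lee_fin natrX lnXn ?ltr0n//.
  rewrite -[_ *+ (q * _)]mulr_natl !natrM le_eqVlt; apply/orP; left; apply/eqP.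
  by field; rewrite pnatr_eq0 -lt0n p0/= nat1r pnatr_eq0.
apply: lee_wpmul2l; first by rewrite lee_fin invr_ge0.
by rewrite lee_lne ?in_itv/= ?leey ?andbT ?lee_fin// (le_trans _ (sepK _)) ?lee_fin.
Qed.

End SeparatedSets.

(** * Covering bounds for the shift *)

Lemma iter_left_shift (R : realType) (k : nat) (x : int -> R) :
  iter k (@left_shift R) x = shift_by k%:Z x.
Proof.
elim: k => [|k IH]; apply/funext => i /=; first by rewrite /shift_by addr0.
by rewrite IH /left_shift /shift_by -addrA -PoszD add1n.
Qed.

Lemma dist_shift_le (R : realType) (x y : int -> R) (c : R) :
  (forall i, `|x i - y i| / 2 ^+ absz i <= c) -> dist_shift x y <= c.
Proof.
move=> H; apply: ge_sup => [|_ [i _ <-]]; last exact: H.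
by eexists; exists 0.
Qed.

(** The uniform bound [M] makes the set of quotients bounded above, so that each of them lies below
    its [sup]. *)
Lemma dist_shift_ge (R : realType) (x y : int -> R) (M : R) (i : int) :
  (forall j, `|x j - y j| <= M) -> `|x i - y i| / 2 ^+ absz i <= dist_shift x y.
Proof.
move=> H; apply: ub_le_sup; last by exists i.
exists M => _ [j _ <-]; rewrite ler_pdivrMr ?exprn_gt0//.
by rewrite (le_trans (H j))// ler_peMr ?exprn_ege1 ?ler1n// (le_trans _ (H j)).
Qed.

Lemma half_pow_anti (R : realType) (m n : nat) :
  (m <= n)%N -> 2 ^- n <= 2 ^- m :> R.
Proof. by move=> mn; rewrite lef_pV2 ?posrE ?exprn_gt0// ler_weXn2l ?ler1n. Qed.

Lemma leq_sqr_self (n : nat) : (n <= n ^ 2)%N.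
Proof. by case: n => // n; rewrite -[X in (X <= _)%N]expn1 leq_pexp2l. Qed.

(** The numerator 2 is the diameter of [0,2]: coordinates farther than [L] from the origin
    contribute at most [e] to the distance. *)
Lemma exists_half_pow_le (R : realType) (e : R) :
  0 < e -> exists L : nat, 2 / 2 ^+ L <= e.
Proof.
move=> e0; exists (Num.trunc (2 / e)).+1.
have e2 : 0 <= 2 / e by rewrite divr_ge0// ltW.
have /andP[_ /ltW h] := truncn_itv e2.
rewrite ler_pdivrMr ?exprn_gt0// mulrC -ler_pdivrMr//.
apply: le_trans h _; rewrite -natrX ler_nat; apply: ltnW; exact: ltn_expl.
Qed.

(** Up to tails of small weight, an orbit segment of length [n] sees only the coordinates from [-L]
    to [n + L - 1], which makes [n + L.*2] code letters. *)
Lemma shift_sep_num_le (R : realType) (A : set R) (K : set (int -> R))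
    (delta : R) (n L M : nat) (c : R -> 'I_M.+1) :
  (forall a, A a -> 0 <= a <= 2) ->
  (forall x, K x -> forall i, A (x i)) ->
  2 / 2 ^+ L <= delta ->
  (forall a b, A a -> A b -> c a = c b -> `|a - b| <= delta) ->
  (sep_num (@left_shift R) (@dist_shift R) n K delta
     <= ((M.+1 ^ (n + L.*2))%:R)%:E)%E.
Proof.
move=> A02 KA Ldelta cA.
pose f (z : int -> R) := [ffun i : 'I_(n + L.*2) => c (z (Posz i - Posz L))].
have := @sep_num_le_card R _ (@left_shift R) (@dist_shift R) _ f n K delta.
rewrite card_ffun !card_ord; apply => w z Kw Kz fwz.
have delta0 : 0 <= delta by apply: le_trans Ldelta; rewrite divr_ge0// exprn_ge0.
apply: bowen_dist_le => // k kn; rewrite !iter_left_shift.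
apply: dist_shift_le => i; rewrite /shift_by.
have wz2 : `|w (i + k) - z (i + k)| <= 2.
  have := A02 _ (KA _ Kw (i + k)); have := A02 _ (KA _ Kz (i + k)).
  by rewrite ler_norml => /andP[? ?] /andP[? ?]; apply/andP; split; lra.
(* Outside the window the weight alone makes the quotient small; inside, equality of the codes
   does. *)
have [iL|Li] := leqP (absz i) L; last first.
  apply: le_trans Ldelta; apply: ler_pM => //.
  by rewrite half_pow_anti// ltnW.
apply: (@le_trans _ _ `|w (i + k) - z (i + k)|).
  by rewrite ler_pdivrMr ?exprn_gt0// ler_peMr// exprn_ege1// ler1n.
apply: cA; [exact: KA|exact: KA|].
have jlt : (absz (i + Posz k + Posz L)%R < n + L.*2)%N by lia.
have := congr1 (fun g : {ffun _ -> _} => g (Ordinal jlt)) fwz.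
rewrite !ffunE /=.
by have -> : Posz (absz (i + Posz k + Posz L)) - Posz L = i + Posz k by lia.
Qed.

Lemma shift_growth_le (R : realType) (A : set R) (K : nat -> set (int -> R))
    (delta : R) (M : nat) (c : R -> 'I_M.+1) :
  (forall a, A a -> 0 <= a <= 2) ->
  (forall n x, K n x -> forall i, A (x i)) ->
  0 < delta ->
  (forall a b, A a -> A b -> c a = c b -> `|a - b| <= delta) ->
  (limn_esup (fun n => ((n%:R)^-1)%:E *
     lne (sep_num (@left_shift R) (@dist_shift R) n (K n) delta))
     <= (ln M.+1%:R)%:E)%E.
Proof.
move=> A02 KA delta0 cA; have [L HL] := exists_half_pow_le delta0.
by apply: (@growth_le _ _ _ _ _ _ _ L.*2) => n; apply: shift_sep_num_le (KA n) HL cA.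
Qed.

(** Cells of length [delta]: the code of [a] is the integer part of [a / delta]. *)
Lemma grid_code (R : realType) (delta : R) : 0 < delta ->
  exists c : R -> 'I_(Num.trunc (2 / delta)).+1, forall a b : R,
    0 <= a <= 2 -> 0 <= b <= 2 -> c a = c b -> `|a - b| <= delta.
Proof.
move=> delta0; exists (fun a => inord (Num.trunc (a / delta))) => a b.
move=> /andP[a0 a2] /andP[b0 b2] /(congr1 val) /=.
rewrite !inordK ?ltnS ?le_truncn// ?ler_pM2r ?invr_gt0// => cab.
have aD : 0 <= a / delta by rewrite divr_ge0// ltW.
have bD : 0 <= b / delta by rewrite divr_ge0// ltW.
have := truncn_itv aD; have := truncn_itv bD; rewrite cab -natr1.
rewrite !ler_pdivlMr// !ltr_pdivrMr// mulrDl mul1r => /andP[tb bt] /andP[ta at'].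
rewrite ler_distl lerBlDr; apply/andP; split.
  by rewrite ltW// (lt_le_trans bt)// lerD2r.
by rewrite ltW// (lt_le_trans at')// lerD2r.
Qed.

(** The code is the position in an enumeration of [A]; the index one past the end serves the points
    outside [A]. *)
Lemma finite_code (R : realType) (A : set R) : finite_set A ->
  exists M (c : R -> 'I_M.+1), forall a b, A a -> A b -> c a = c b -> a = b.
Proof.
move=> /finite_fsetP[B ->]; exists #|` B|%fset.
exists (fun a => inord (index a B)) => a b Ba Bb /(congr1 val) /=.
rewrite !inordK ?ltnS ?index_size// => ab.
by rewrite -(nth_index 0 Ba) ab nth_index.
Qed.

Lemma near_ln_inv_ge (R : realType) (C : R) :
  \forall delta \near (0 : R)^'+, 0 < delta < 1 /\ C <= ln delta^-1.
Proof.
near=> delta.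
have d0 : 0 < delta by near: delta; exact: nbhs_right_gt.
have d1 : delta < 1 by near: delta; exact: nbhs_right_lt.
split; first by rewrite d0 d1.
rewrite lnV ?posrE// lerNr -ler_expR lnK ?posrE//.
by near: delta; apply: nbhs_right_le; exact: expR_gt0.
Unshelve. all: by end_near. Qed.

(** There are at most [2 / delta + 1 <= 3 / delta] cells, and [ln 3] is at most [e * ln delta^-1]
    for small [delta]. *)
Lemma near_ln_grid (R : realType) (e : R) : 0 < e ->
  \forall delta \near (0 : R)^'+, 0 < delta /\
    ((ln (Num.trunc (2 / delta)).+1%:R)%:E * ((ln delta^-1)^-1)%:E <= (1 + e)%:E)%E.
Proof.
move=> e0; have := near_ln_inv_ge (ln 3 / e : R).
apply: filterS => delta [/andP[d0 d1]].
have l0 : 0 < ln delta^-1 by rewrite ln_gt0// invf_gt1.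
rewrite ler_pdivrMr// => Hl; split=> //.
rewrite -EFinM lee_fin ler_pdivrMr// [(1 + e) * _]mulrDl mul1r.
apply: (@le_trans _ _ (ln (delta^-1 * 3))).
  rewrite ler_ln ?posrE ?mulr_gt0 ?invr_gt0//.
  have d2 : 0 <= 2 / delta by rewrite divr_ge0// ltW.
  have /andP[h _] := truncn_itv d2.
  have h1 : 1 <= delta^-1 by rewrite invf_ge1// ltW.
  rewrite -[(Num.trunc _).+1%:R]natr1 (le_trans (lerD h h1))//.
  by rewrite le_eqVlt; apply/orP; left; apply/eqP; ring.
by rewrite lnM ?posrE ?invr_gt0// lerD2l [e * _]mulrC.
Qed.

(** * The levels of X *)

Lemma shift_byD (R : realType) (k l : int) (x : int -> R) :
  shift_by k (shift_by l x) = shift_by (k + l) x.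
Proof. by apply/funext => i; rewrite /shift_by addrA. Qed.

Lemma shift_by0 (R : realType) (x : int -> R) : shift_by 0 x = x.
Proof. by apply/funext => i; rewrite /shift_by addr0. Qed.

(** The largest element is 2^-n + 2^(n^2-n) 2^-(n^2) = 2 * 2^-n, which is at most 1. *)
Lemma G_bounds (R : realType) (n : nat) (a : R) : (0 < n)%N -> G n a -> 0 <= a <= 1.
Proof.
move=> n0 [k /andP[_ kle] ->]; apply/andP; split.
  by rewrite addr_ge0 ?mulr_ge0 ?invr_ge0 ?exprn_ge0.
have nn := leq_sqr_self n.
have h : k%:R * 2 ^- (n ^ 2) <= 2 ^- n :> R.
  rewrite ler_pdivrMr ?exprn_gt0// ler_pdivlMl ?exprn_gt0// -!natrX -natrM ler_nat.
  by apply: (leq_trans (leq_mul (leqnn _) kle)); rewrite -expnD subnKC.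
have := half_pow_anti R n0; rewrite expr1; lra.
Qed.

Lemma finite_G (R : realType) (n : nat) : finite_set (@G R n).
Proof.
apply: (@sub_finite_set _ _ ((fun k : nat => 2 ^- n + k%:R * 2 ^- (n ^ 2)%N : R) @` `I_(2 ^ (n ^ 2 - n)).+1)).
  by move=> a [k /andP[_ kle] ->]; exists k.
exact: finite_image (finite_II _).
Qed.

Definition alphabet (R : realType) (n : nat) : set R :=
  if n is 0 then [set 0; 2] else G n `|` [set 2].

Lemma finite_alphabet (R : realType) (n : nat) : finite_set (@alphabet R n).
Proof.
case: n => [|n]; first exact: finite_set2.
by rewrite /alphabet finite_setU; split; [exact: finite_G | exact: finite_set1].
Qed.

(** The symbol 2 is at distance at least 1 from every other symbol, so points closer than 1 at a
    coordinate agree on whether it is 2. *)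
Lemma alphabetP (R : realType) (n : nat) (a : R) :
  alphabet n a -> a = 2 \/ 0 <= a <= 1.
Proof.
case: n => [|n] [].
- by move=> ->; right; rewrite lexx ler01.
- by move=> ->; left.
- by move=> /G_bounds h; right; exact: h.
- by move=> ->; left.
Qed.

Lemma alphabet_bounds (R : realType) (n : nat) (a : R) :
  alphabet n a -> 0 <= a <= 2.
Proof. move=> /alphabetP[->|/andP[a0 a1]]; apply/andP; split; lra. Qed.

Section Levels.
Variables (R : realType) (P : nat -> nat).

Lemma XlevelP (n : nat) (x : int -> R) : (0 < n)%N ->
  Xlevel P n x <-> exists i : int, forall j : int,
    if (Posz (P n) %| j + i)%Z then x j = 2 else G n (x j).
Proof.
case: n => // n _; split.
  move=> [i _ [y Xy <-]]; exists i => j; exact: (Xy (j + i)).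
move=> [i Hx]; exists i => //; exists (shift_by (- i) x).
  by move=> j; have := Hx (j - i); rewrite subrK.
by rewrite shift_byD subrr shift_by0.
Qed.

Lemma Xlevel_alphabet (n : nat) (x : int -> R) :
  Xlevel P n x -> forall i, alphabet n (x i).
Proof.
case: n => [[->|[x02 _]] i|n /XlevelP-/(_ isT)[i Hx] j]; [by left|exact: x02|].
by have := Hx j; case: ifP => _; [right|left].
Qed.

Lemma Xlevel_shift (n : nat) (k : int) (x : int -> R) :
  Xlevel P n x -> Xlevel P n (shift_by k x).
Proof.
case: n => [[->|[x02 [i [xi iuniq]]]]|n /XlevelP-/(_ isT)[i Hx]].
- by left.
- right; split; first by move=> j; exact: x02.
  exists (i - k); split; first by rewrite /shift_by subrK.
  by move=> j /iuniq ->; rewrite addrK.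
- apply/XlevelP => //; exists (i + k) => j.
  by have := Hx (j + k); rewrite -addrA (addrC k).
Qed.

Lemma Xlevel_shiftE (n : nat) (k : int) (x : int -> R) :
  Xlevel P n (shift_by k x) -> Xlevel P n x.
Proof. by move/(Xlevel_shift (- k)); rewrite shift_byD addNr shift_by0. Qed.

Lemma Xlevel_X (n : nat) (x : int -> R) : Xlevel P n x -> X P x.
Proof. by exists n. Qed.

Lemma X_shift (k : int) (x : int -> R) : X P x -> X P (shift_by k x).
Proof. by move=> [n _ Hx]; exists n => //; exact: Xlevel_shift. Qed.

Lemma X_bounds (x : int -> R) : X P x -> forall i, 0 <= x i <= 2.
Proof. by move=> [n _ Hx] i; exact: alphabet_bounds (Xlevel_alphabet Hx i). Qed.

Lemma X_dist_coord_le2 (x y : int -> R) : X P x -> X P y -> forall i, `|x i - y i| <= 2.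
Proof.
move=> Xx Xy i; have /andP[? ?] := X_bounds Xx i; have /andP[? ?] := X_bounds Xy i.
rewrite ler_norml; apply/andP; split; lra.
Qed.

Lemma X_dist_coord_le (x y : int -> R) : X P x -> X P y ->
  `|x 0 - y 0| <= dist_shift x y.
Proof.
move=> Xx Xy; have := dist_shift_ge 0 (X_dist_coord_le2 Xx Xy).
by rewrite expr0 divr1.
Qed.

Hypothesis P_pos : forall m, (0 < m)%N -> (0 < P m)%N.
Hypothesis P_incr : forall m n, (0 < m)%N -> (m < n)%N -> (P m < P n)%N.

Lemma Xlevel0_two (x : int -> R) : Xlevel P 0 x ->
  exists K : int, forall j, K <= j -> x j <> 2.
Proof.
move=> [->|[_ [i [_ iuniq]]]]; first by exists 0 => j _ /esym/eqP; rewrite pnatr_eq0.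
by exists (i + 1) => j ij /iuniq; lia.
Qed.

Lemma XlevelS_two (n : nat) (x : int -> R) : (0 < n)%N -> Xlevel P n x ->
  exists i : int, forall j, x j = 2 <-> (Posz (P n) %| j + i)%Z.
Proof.
move=> n0 /(XlevelP _ n0)[i Hx]; exists i => j.
have := Hx j; case: ifP => // _ /(G_bounds n0)/andP[_ le1]; split=> // x2.
by exfalso; lra.
Qed.

Lemma dvdz_far (p : nat) (i K : int) : (0 < p)%N ->
  exists2 j, K <= j & (Posz p %| j + i)%Z.
Proof.
move=> p0; exists (Posz p * Posz (absz K + absz i)%N - i).
  have : Posz (absz K + absz i)%N <= Posz p * Posz (absz K + absz i)%N by nia.
  lia.
by rewrite subrK dvdz_mulr.
Qed.

(* Two points of [X] whose coordinates stay closer than 1 share the positions of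
   the symbol 2 from some time on, and these positions determine the level. *)
Lemma Xlevel_eventually (n : nat) (w z : int -> R) (K : int) :
  Xlevel P n w -> X P z -> (forall j, K <= j -> `|z j - w j| < 1) -> Xlevel P n z.
Proof.
move=> Xw [m _ Xz] close.
have two j : K <= j -> z j = 2 <-> w j = 2.
  move=> /close; rewrite ltr_norml => /andP[h1 h2].
  have /alphabetP := Xlevel_alphabet Xw j; have /alphabetP := Xlevel_alphabet Xz j.
  by move=> [zj|/andP[? ?]] [wj|/andP[? ?]]; split=> ?; lra.
case: (posnP m) (posnP n) => [m0|m0] [n0|n0].
- by rewrite n0 -m0.
(* A point of level 0 has at most one symbol 2, a point of positive level has them arbitrarily far
   to the right. *)
- subst m; have [K' HK'] := Xlevel0_two Xz; have [i Hi] := XlevelS_two n0 Xw.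
  have [j jK /Hi/two h] := dvdz_far i (Num.max K K') (P_pos n0).
  by exfalso; apply: (HK' j); [lia|apply: h; lia].
- subst n; have [K' HK'] := Xlevel0_two Xw; have [i Hi] := XlevelS_two m0 Xz.
  have [j jK /Hi h] := dvdz_far i (Num.max K K') (P_pos m0).
  by exfalso; apply: (HK' j); [lia|apply/two; [lia|]].
- have [i Hi] := XlevelS_two n0 Xw; have [i' Hi'] := XlevelS_two m0 Xz.
  have both j : K <= j -> (Posz (P n) %| j + i)%Z = (Posz (P m) %| j + i')%Z.
    by move=> Kj; apply/idP/idP => [/Hi/(two _ Kj)/Hi'|/Hi'/(two _ Kj)/Hi].
  have [j Kj dj] := dvdz_far i K (P_pos n0).
  (* A step of one period of either progression from the common position [j] stays in both, so each
     period divides the other. *)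
  have dj' : (Posz (P m) %| j + i')%Z by rewrite -both.
  have PmPn : (P m %| P n)%N.
    have : (Posz (P m) %| (j + P n) + i')%Z by rewrite -both; [rewrite addrAC rpredD|lia].
    by rewrite addrAC rpredDl.
  have PnPm : (P n %| P m)%N.
    have : (Posz (P n) %| (j + P m) + i)%Z by rewrite both; [rewrite addrAC rpredD|lia].
    by rewrite addrAC rpredDl.
  have PP : P n = P m by apply/eqP; rewrite eqn_dvd PnPm.
  suff -> : n = m by [].
  by case: (ltngtP n m) => // /P_incr; [move/(_ n0)|move/(_ m0)]; rewrite PP ltnn.
Qed.

(** This makes the proportion [1 - 1 / P n] of free positions tend to 1. *)
Lemma P_ge (n : nat) : (n <= P n)%N.
Proof.
elim: n => // -[|n] IH; first exact: P_pos.
by apply: leq_ltn_trans IH _; exact: P_incr.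
Qed.

End Levels.

(** * Lower bounds from freely chosen coordinates *)

(* The cardinality of [G n] *)
Definition level_size (n : nat) : nat := 2 ^ (n ^ 2 - n).

Section CodedPoints.
Variables (R : realType) (P : nat -> nat) (n : nat).
Hypothesis n_gt0 : (0 < n)%N.

(** A point of X_n whose free coordinates are prescribed by [c]; the successor appears because the
    indices in [G n] start at 1. *)
Definition coded_point (c : int -> nat) : int -> R := fun j =>
  if (Posz (P n) %| j)%Z then 2 else 2 ^- n + (c j).+1%:R * 2 ^- (n ^ 2)%N.

Lemma coded_point_level (c : int -> nat) :
  (forall j, (c j < level_size n)%N) -> Xlevel P n (coded_point c).
Proof.
move=> cn; apply/XlevelP => //; exists 0 => j; rewrite addr0 /coded_point.
by case: ifP => Pj; rewrite Pj // /G /=; exists (c j).+1 => //; exact: cn.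
Qed.

(** Codes differ by less than 2^(n^2-n) grid steps of size 2^-(n^2). *)
Lemma coded_point_dist (c c' : int -> nat) (j : int) :
  (forall j, (c j < level_size n)%N) -> (forall j, (c' j < level_size n)%N) ->
  `|coded_point c j - coded_point c' j| <= 2 ^- n.
Proof.
move=> cn c'n; rewrite /coded_point; case: ifP => _; first by rewrite subrr normr0.
have nn := leq_sqr_self n.
rewrite opprD addrACA subrr add0r -mulrBl normrM normfV normrX normr_nat//.
rewrite ler_pdivrMr ?exprn_gt0// -[X in _ * 2 ^+ X](subnKC nn) exprD mulKf ?expf_neq0//.
rewrite -natrX -/(level_size n).
have := cn j; have := c'n j; rewrite -!(ltr_nat R) -!natr1 => h1 h2.
have : 0 <= (c j)%:R :> R by [].
have : 0 <= (c' j)%:R :> R by [].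
move=> h3 h4; rewrite ler_norml; apply/andP; split; lra.
Qed.

Lemma coded_point_gap (c c' : int -> nat) (j : int) :
  ~~ (Posz (P n) %| j)%Z -> c j != c' j ->
  2 ^- (n ^ 2)%N <= `|coded_point c j - coded_point c' j|.
Proof.
move=> /negbTE Pj cc'; rewrite /coded_point Pj.
rewrite opprD addrACA subrr add0r -mulrBl normrM normfV normrX normr_nat//.
rewrite ler_peMl ?invr_ge0 ?exprn_ge0//.
have lt_dist k l : (k < l)%N -> 1 <= `|l.+1%:R - k.+1%:R| :> R.
  move=> kl; rewrite -natrB; last by rewrite ltnS ltnW.
  by rewrite subSS normr_nat ler1n subn_gt0.
by case: (ltngtP (c j) (c' j)) cc' => // /lt_dist h _; rewrite // distrC.
Qed.

End CodedPoints.

Lemma card_nondivisible (p t : nat) : (0 < p)%N ->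
  #|[pred k : 'I_(p * t) | ~~ (p %| k)%N]| = (p.-1 * t)%N.
Proof.
move=> p0; have := cardC [pred k : 'I_(p * t) | p %| k]%N.
have -> : #|[pred k : 'I_(p * t) | p %| k]%N| = t.
  rewrite -sum1_card big_mkcond -(big_mkord xpredT (fun k => if (p %| k)%N then 1 else 0)%N).
  case: t => [|t]; first by rewrite muln0 big_geq.
  (* The multiple 0 is split off because [divn_count_dvd] counts from 1. *)
  rewrite big_ltn ?muln_gt0 ?p0// dvdn0.
  have -> : (p * t.+1 = (p * t + p.-1).+1)%N by rewrite mulnS; lia.
  transitivity (1 + \sum_(1 <= i < (p * t + p.-1).+1) (p %| i))%N.
    by congr addn; apply: eq_bigr => i _; case: (p %| i)%N.
  by rewrite -divn_count_dvd mulnC divnMDl// divn_small ?addn0 ?add1n// prednK.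
rewrite card_ord => h.
have -> : #|[pred k : 'I_(p * t) | ~~ (p %| k)%N]| = #|[predC [pred k : 'I_(p * t) | p %| k]%N]|.
  by apply: eq_card.
by apply: (@addnI t); rewrite h -mulSn prednK.
Qed.

(** The padding by 0 makes all coded points agree from coordinate [N] on, as the asymptotic
    counterpart requires. *)
Definition word_code (N a : nat) (f : 'I_N -> 'I_a.+1) (j : int) : nat :=
  match j with
  | Posz k => if insub k is Some i then f i else 0
  | Negz _ => 0
  end.

Lemma word_code_lt (N a : nat) (f : 'I_N -> 'I_a.+1) (j : int) : (word_code f j < a.+1)%N.
Proof. by case: j => //= k; case: insub. Qed.

Lemma word_code_ord (N a : nat) (f : 'I_N -> 'I_a.+1) (i : 'I_N) :
  word_code f (Posz i) = f i.
Proof. by rewrite /= valK. Qed.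

Lemma word_code_ge (N a : nat) (f : 'I_N -> 'I_a.+1) (j : int) :
  Posz N <= j -> word_code f j = 0%N.
Proof. by case: j => //= k; rewrite lez_nat => h; rewrite insubF// ltnNge h. Qed.

(** Each of the [(P n).-1 * t] free positions below [P n * t] takes [level_size n] values
    independently, and distinct choices are separated at the time when a differing coordinate
    reaches the origin. *)
Lemma sep_num_coded (R : realType) (P : nat -> nat) (n t : nat)
    (K : set (int -> R)) (delta : R) :
  (0 < n)%N -> (0 < P n)%N -> delta < 2 ^- (n ^ 2)%N ->
  (forall c, (forall j, (c j < level_size n)%N) ->
     (forall j, Posz (P n * t) <= j -> c j = 0%N) -> K (coded_point R P n c)) ->
  (((level_size n ^ ((P n).-1 * t))%:R)%:E <=
    sep_num (@left_shift R) (@dist_shift R) (P n * t) K delta)%E.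
Proof.
move=> n0 Pn0 deltan KP; set N := (P n * t)%N.
have a0 : (0 < level_size n)%N by rewrite expn_gt0.
set a := (level_size n).-1; have aE : level_size n = a.+1 by rewrite prednK.
pose S := [pred k : 'I_N | ~~ (P n %| k)%N].
(* Words are set to 0 at the multiples of [P n], where the point is 2 whatever the code; hence
   distinct words give distinct points. *)
pose D : pred {ffun 'I_N -> 'I_a.+1} := pffun_on ord0 S predT.
pose x (f : {ffun 'I_N -> 'I_a.+1}) := coded_point R P n (word_code f).
have clt (f : {ffun 'I_N -> 'I_a.+1}) j : (word_code f j < level_size n)%N.
  by rewrite aE word_code_lt.
have gap f g : f \in D -> g \in D -> f != g ->
    exists2 k : 'I_N, (k < N)%N & 2 ^- (n ^ 2)%N <= `|x f k - x g k|.
  move=> /pffun_onP[Sf _] /pffun_onP[Sg _] fg.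
  have [k fgk] : exists k, f k != g k.
    apply/existsP; apply: contraR fg => /existsPn H.
    by apply/eqP/ffunP => k; apply/eqP/negPn/H.
  exists k => //; apply: coded_point_gap; last by rewrite !word_code_ord.
  have [//|/negPn kS] := boolP (~~ (P n %| k)%N).
  have out (h : {ffun 'I_N -> 'I_a.+1}) : ord0.-support h \subset S -> h k = ord0.
    move=> /fintype.subsetP/(_ k); rewrite !inE kS => H.
    by apply/eqP/negPn/negP => /H.
  by move: fgk; rewrite (out _ Sf) (out _ Sg) eqxx.
pose H := [fset x f | f in D]%fset.
have cardH : #|` H|%fset = (level_size n ^ ((P n).-1 * t))%N.
  rewrite card_in_imfset /=; last first.
    move=> f g fD gD xfg; apply/eqP/negPn/negP => /(gap _ _ fD gD)[k _].
    by rewrite xfg subrr normr0 leNgt invr_gt0 exprn_gt0.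
  by rewrite -cardE card_pffun_on card_nondivisible// cardT size_enum_ord -aE.
rewrite -cardH; apply: sep_num_ge.
  move=> _ /= /imfsetP[f _ ->]; apply: KP; first exact: clt.
  by move=> j; exact: word_code_ge.
move=> _ _ /imfsetP[f fD ->] /imfsetP[g gD ->] xfg.
have fg : f != g by apply: contraNneq xfg => ->.
have [k kN h] := gap f g fD gD fg.
apply: (lt_le_trans deltan); apply: (le_trans h).
apply: le_trans (bowen_dist_ge _ _ _ _ kN); rewrite !iter_left_shift.
have Xx h' : X P (shift_by (Posz k) (x h')).
  by apply/X_shift/(@Xlevel_X _ _ n)/coded_point_level.
by have := X_dist_coord_le (Xx f) (Xx g); rewrite /shift_by add0r.
Qed.

(** * Comparing the growth rate of level n with the scale *)

(** Here [n.+1] is the least [m] with [2 ^- (m ^ 2) <= delta]. *)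
Lemma half_pow_sq_bracket (R : realType) (N : nat) (delta : R) :
  0 < delta -> delta < 2 ^- (N ^ 2)%N ->
  exists2 n, (N <= n)%N & 2 ^- (n.+1 ^ 2)%N <= delta < 2 ^- (n ^ 2)%N.
Proof.
move=> delta0 deltaN.
have anti m k : (m <= k)%N -> 2 ^- (k ^ 2)%N <= 2 ^- (m ^ 2)%N :> R.
  by move=> mk; rewrite half_pow_anti// leq_sqr.
have ex : exists m, 2 ^- (m ^ 2)%N <= delta.
  have [L HL] := exists_half_pow_le delta0; exists L.
  apply: le_trans HL; apply: (@le_trans _ _ (2 ^- L)).
    exact: half_pow_anti (leq_sqr_self L).
  by rewrite ler_peMl ?invr_ge0 ?exprn_ge0// ler1n.
have := ex_minnP ex; case=> m mdelta mmin.
have Nm : (N < m)%N.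
  by rewrite ltnNge; apply/negP => /anti h; have := lt_le_trans deltaN (le_trans h mdelta);
    rewrite ltxx.
case: m mdelta mmin Nm => // m mdelta mmin Nm; exists m => //.
by rewrite mdelta/= ltNge; apply/negP => /mmin; rewrite ltnn.
Qed.

(** The numerator is at least (n-1)^2 ln 2, the denominator at most (n+1)^2 ln 2, and
    ((n-1)/(n+1))^2 = (1 - 2/(n+1))^2 >= 1 - 4/(n+1). *)
Lemma level_growth_ratio (R : realType) (n p : nat) (e delta : R) :
  (0 < n)%N -> (n <= p)%N -> 0 < delta < 1 -> 2 ^- (n.+1 ^ 2)%N <= delta ->
  4 / n.+1%:R <= e ->
  1 - e <= p.-1%:R / p%:R * ln (level_size n)%:R / ln delta^-1.
Proof.
move=> n0 np /andP[delta0 delta1] ndelta ne.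
have ld0 : 0 < ln delta^-1 by rewrite ln_gt0// invf_gt1.
have p0 : (0 < p)%N by apply: leq_trans np.
have l2 : 0 < ln 2 :> R by rewrite ln_gt0// ltr1n.
have ldle : ln delta^-1 <= n.+1%:R ^+ 2 * ln 2.
  rewrite -natrX mulr_natl -lnXn ?ltr0n// ler_ln ?posrE ?exprn_gt0 ?invr_gt0//.
  by rewrite invf_ple ?posrE ?exprn_gt0.
rewrite ler_pdivlMr//.
have lsz : ln (level_size n)%:R = (n%:R ^+ 2 - n%:R) * ln 2 :> R.
  have nn := leq_sqr_self n.
  by rewrite /level_size natrX lnXn ?ltr0n// -[ln 2 *+ _]mulr_natl natrB// natrX.
have n1 : 1 <= n%:R :> R by rewrite ler1n.
have npR : n%:R <= p%:R :> R by rewrite ler_nat.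
have pR : 0 < p%:R :> R by rewrite ltr0n.
have key : (n%:R - 1) ^+ 2 * ln 2 <= p.-1%:R / p%:R * ln (level_size n)%:R :> R.
  rewrite lsz mulrA ler_pM2r// mulrAC ler_pdivlMr// -subn1 natrB//.
  (* After clearing [p] and [ln 2], the difference of the two sides is exactly this product. *)
  have : 0 <= (n%:R - 1) * (p%:R - n%:R) :> R by rewrite mulr_ge0// subr_ge0.
  move=> h; rewrite -subr_ge0; apply: le_trans h _; rewrite le_eqVlt; apply/orP; left;
    by apply/eqP; ring.
apply: le_trans key.
have [e1|e1] := leP e 1; last first.
  apply: (@le_trans _ _ 0); first by apply: mulr_le0_ge0; rewrite ?subr_le0 ltW.
  by rewrite mulr_ge0 ?sqr_ge0 ?ltW.
apply: (@le_trans _ _ ((1 - e) * (n.+1%:R ^+ 2 * ln 2))).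
  by rewrite ler_wpM2l// subr_ge0.
rewrite mulrA ler_pM2r//.
move: ne; rewrite ler_pdivrMr ?ltr0n// -[n.+1%:R]natr1.
move: (n%:R : R) n1 => x x1 ne.
have : 0 <= (e * (x + 1) - 4) * (x + 1) by rewrite mulr_ge0 ?subr_ge0//; lra.
nra.
Qed.

(** * The four numbers for an abstract family of sets *)

Section GrowthNumbers.
Variables (R : realType) (P : nat -> nat).
Hypothesis P_pos : forall m, (0 < m)%N -> (0 < P m)%N.
Hypothesis P_incr : forall m n, (0 < m)%N -> (m < n)%N -> (P m < P n)%N.

(* The dependence of [K n w] on the time n serves the preimage counterpart, where
   it is [preim_iter n (Gamma_eps eps w)]. *)
Variable K : nat -> (int -> R) -> set (int -> R).

Let q (w : int -> R) (delta : R) : \bar R :=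
  limn_esup (fun n => ((n%:R)^-1)%:E *
    lne (sep_num (@left_shift R) (@dist_shift R) n (K n w) delta))%E.

Hypothesis K_level : forall m n w, Xlevel P m w -> K n w `<=` Xlevel P m.
Hypothesis K_neq0 : forall n w, X P w -> K n w !=set0.
(** One base point [w] serves all [t], so the growth along the times [P n * t] belongs to a single
    point; [N] leaves room for requiring that [2 ^- n] be at most [eps]. *)
Hypothesis K_coded : exists N, forall n, (0 < n)%N -> (N <= n)%N ->
  exists2 w, X P w & forall t c, (forall j, (c j < level_size n)%N) ->
     (forall j, Posz (P n * t) <= j -> c j = 0%N) ->
     K (P n * t)%N w (coded_point R P n c).

Lemma four_growth_numbers_eq :
  [/\ upper_int (X P) q = 1%E, lower_int (X P) q = 1%E,
      upper_ext (X P) q = 0%E & lower_ext (X P) q = 0%E].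
Proof.
apply: four_numbers_eq.
- by exists (fun=> 0); exists 0%N => //; left.
- move=> e e0; apply: filterS2 (near_ln_grid e0) (near_ln_inv_ge 1).
  move=> delta [delta0 le1e] [/andP[_ delta1] _] w [m _ Xw].
  have [c cP] := grid_code delta0.
  apply: le_trans le1e; apply: lee_wpmul2r.
    by rewrite lee_fin invr_ge0 ln_ge0// invf_ge1// ltW.
  apply: (@shift_growth_le R [set a | 0 <= a <= 2] _ delta _ c) => //.
  by move=> n x /(K_level Xw)/Xlevel_X/X_bounds; apply.
- move=> e e0; have [N KN] := K_coded.
  (* Large enough for coded points to be available and for [4 / n.+1 <= e]. *)
  pose n1 := maxn N (Num.trunc (4 / e)).+1.
  have n1gt : 0 < 2 ^- (n1 ^ 2)%N :> R by rewrite invr_gt0 exprn_gt0.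
  apply: filterS2 (near_ln_inv_ge 0) (nbhs_right_lt n1gt) => delta.
  move=> [/andP[delta0 delta1] _] deltan1.
  have [n n1n /andP[ndelta deltan]] := half_pow_sq_bracket delta0 deltan1.
  have n0 : (0 < n)%N by apply: leq_trans n1n; rewrite leq_max orbT.
  have [w Xw Kw] := KN n n0 (leq_trans (leq_maxl _ _) n1n).
  exists w => //.
  have ld0 : 0 < ln delta^-1 by rewrite ln_gt0// invf_gt1.
  apply: (@le_trans _ _ (((P n).-1%:R / (P n)%:R * ln (level_size n)%:R)%:E * ((ln delta^-1)^-1)%:E)%E).
    rewrite -EFinM lee_fin; apply: level_growth_ratio => //.
    + exact: P_ge.
    + by rewrite delta0.
    + rewrite ler_pdivrMr ?ltr0n// -ler_pdivrMl// mulrC.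
      have d4 : 0 <= 4 / e by rewrite divr_ge0// ltW.
      have /andP[_ /ltW h] := truncn_itv d4; apply: le_trans h _.
      by rewrite ler_nat (leq_trans _ (leqnSn n))// (leq_trans _ n1n)// leq_maxr.
  apply: lee_wpmul2r; first by rewrite lee_fin invr_ge0 ltW.
  apply: growth_ge; [by rewrite expn_gt0|exact: P_pos|].
  by move=> t; apply: sep_num_coded => //; [exact: P_pos|exact: Kw].
- move=> w [m _ Xw] e e0.
  (* The finite alphabet is coded exactly, so [M] depends on the level of [w] but not on [delta],
     and division by [ln delta^-1] sends the bound to 0. *)
  have [M [c cP]] := finite_code (@finite_alphabet R m).
  have l0 : 0 <= ln M.+1%:R :> R by rewrite ln_ge0// ler1n.
  apply: filterS2 (near_ln_inv_ge (ln M.+1%:R / e)) (near_ln_inv_ge 1) => delta.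
  move=> [/andP[delta0 delta1] lndelta] _.
  have ld0 : 0 < ln delta^-1 by rewrite ln_gt0// invf_gt1.
  apply: (@le_trans _ _ ((ln M.+1%:R)%:E * ((ln delta^-1)^-1)%:E)%E); last first.
    by rewrite -EFinM lee_fin ler_pdivrMr// mulrC -ler_pdivrMr.
  apply: lee_wpmul2r; first by rewrite lee_fin invr_ge0 ltW.
  apply: (@shift_growth_le R (@alphabet R m) _ delta _ c) => //.
  + by move=> a /alphabet_bounds.
  + by move=> n x /(K_level Xw)/Xlevel_alphabet; apply.
  + by move=> a b Aa Ab /(cP _ _ Aa Ab) ->; rewrite subrr normr0 ltW.
- move=> w Xw; apply: filterS (near_ln_inv_ge 0) => delta [/andP[delta0 delta1] ld0].
  apply: mule_ge0; last by rewrite lee_fin invr_ge0.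
  by apply: growth_ge0 => n; exact: K_neq0.
Qed.

End GrowthNumbers.

(** * The three families of sets *)

Section Families.
Variables (R : realType) (P : nat -> nat).
Hypothesis P_pos : forall m, (0 < m)%N -> (0 < P m)%N.
Hypothesis P_incr : forall m n, (0 < m)%N -> (m < n)%N -> (P m < P n)%N.

Let T := @left_shift R.
Let d := @dist_shift R.
Let W : set (int -> R) := @X R P.

Lemma coord_le_iter_dist (k : nat) (x y : int -> R) : W x -> W y ->
  `|x k - y k| <= d (iter k T x) (iter k T y).
Proof.
move=> Wx Wy; rewrite !iter_left_shift.
by have := X_dist_coord_le (X_shift k Wx) (X_shift k Wy); rewrite /shift_by add0r.
Qed.

Lemma Gamma_as_level (m : nat) (w : int -> R) :
  Xlevel P m w -> Gamma_as W T d w `<=` Xlevel P m.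
Proof.
move=> Xw z [Wz /cvgrPdist_lt/(_ 1 ltr01)[N _ HN]].
apply: (Xlevel_eventually P_pos P_incr (K := Posz N) Xw Wz).
case=> // k; rewrite lez_nat => Nk.
apply: le_lt_trans (coord_le_iter_dist k Wz (Xlevel_X Xw)) _.
by have := HN k Nk; rewrite /= sub0r normrN => /(le_lt_trans (ler_norm _)).
Qed.

(** After [k >= N + L] shifts the points differ only at indices below [-L], where the weights are at
    most [2 ^- L]. *)
Lemma Gamma_as_eventually_eq (N : nat) (w z : int -> R) : W w -> W z ->
  (forall j, Posz N <= j -> z j = w j) -> Gamma_as W T d w z.
Proof.
move=> Ww Wz wz; split=> //; apply/cvgrPdist_le => e e0.
have [L HL] := exists_half_pow_le e0.
exists (N + L)%N => // k /= NLk; rewrite sub0r normrN.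
have d0 : 0 <= d (iter k T z) (iter k T w).
  exact: le_trans (normr_ge0 _) (coord_le_iter_dist k Wz Ww).
rewrite ger0_norm// !iter_left_shift; apply: dist_shift_le => i; rewrite /shift_by.
have [Ni|iN] := leP (Posz N) (i + Posz k).
  by rewrite wz// subrr normr0 mul0r ltW.
apply: le_trans HL; apply: ler_pM => //; first exact: (X_dist_coord_le2 Wz Ww).
by rewrite half_pow_anti//; lia.
Qed.

Lemma Dint_Dext_as :
  [/\ Dint_as_upper W T d = 1%E, Dint_as_lower W T d = 1%E,
      Dext_as_upper W T d = 0%E & Dext_as_lower W T d = 0%E].
Proof.
apply: (@four_growth_numbers_eq R P P_pos P_incr (fun _ w => Gamma_as W T d w)).
- by move=> m _ w; exact: Gamma_as_level.
- by move=> _ w Ww; exists w; apply: (@Gamma_as_eventually_eq 0).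
- exists 0%N => n n0 _; have s0 (j : int) : (0 < level_size n)%N by rewrite expn_gt0.
  have W0 : W (coded_point R P n (fun=> 0%N)) by exact: Xlevel_X (coded_point_level R P n0 s0).
  exists (coded_point R P n (fun=> 0%N)) => // t c cn c0.
  apply: (@Gamma_as_eventually_eq (P n * t)) => //.
    exact: Xlevel_X (coded_point_level R P n0 cn).
  by move=> j /c0; rewrite /coded_point => ->.
Qed.

Variable eps : R.
Hypothesis eps_gt0 : 0 < eps.
Hypothesis eps_lt1 : eps < 1.

Lemma dist_shift_xx (x : int -> R) : d x x = 0.
Proof.
apply/eqP; rewrite eq_le; apply/andP; split.
  by apply: dist_shift_le => i; rewrite subrr normr0 mul0r.
have xx j : `|x j - x j| <= 0 by rewrite subrr normr0.
by apply: le_trans (dist_shift_ge 0 xx); rewrite divr_ge0 ?exprn_ge0.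
Qed.

(** Since [eps < 1], shadowing in forward time keeps the symbol 2 in place at all nonnegative
    positions, which fixes the level. *)
Lemma Gamma_eps_level (m : nat) (w : int -> R) :
  Xlevel P m w -> Gamma_eps W T d eps w `<=` Xlevel P m.
Proof.
move=> Xw z [Wz wz]; apply: (Xlevel_eventually P_pos P_incr (K := 0) Xw Wz).
case=> // k _; apply: le_lt_trans eps_lt1; apply: le_trans (wz k).
exact: coord_le_iter_dist Wz (Xlevel_X Xw).
Qed.

(** Coded points of one level share the positions of 2 and differ elsewhere by at most [2 ^- n], so
    they shadow each other at every time. *)
Lemma coded_Gamma_eps (n : nat) (c c' : int -> nat) : (0 < n)%N ->
  2 ^- n <= eps ->
  (forall j, (c j < level_size n)%N) -> (forall j, (c' j < level_size n)%N) ->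
  Gamma_eps W T d eps (coded_point R P n c') (coded_point R P n c).
Proof.
move=> n0 neps cn c'n; split; first exact: Xlevel_X (coded_point_level R P n0 cn).
move=> k; rewrite !iter_left_shift; apply: dist_shift_le => i; rewrite /shift_by.
apply: le_trans neps; rewrite ler_pdivrMr ?exprn_gt0//.
apply: le_trans (coded_point_dist R P (i + k) cn c'n) _.
by rewrite ler_peMr ?invr_ge0 ?exprn_ge0// exprn_ege1// ler1n.
Qed.

(** For the preimage counterpart: a shift by a multiple of the period preserves the positions of 2
    and only moves the code. *)
Lemma shift_coded_point (n t : nat) (c : int -> nat) :
  shift_by (Posz (P n * t)) (coded_point R P n c) =
  coded_point R P n (fun j => c (j + Posz (P n * t))).
Proof.
apply/funext => j; rewrite /shift_by /coded_point.
by rewrite [X in if X then _ else _]rpredDr// PoszM dvdz_mulr.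
Qed.

Lemma Dint_Dext_eps :
  [/\ Dint_upper W T d eps = 1%E, Dint_lower W T d eps = 1%E,
      Dext_upper W T d eps = 0%E & Dext_lower W T d eps = 0%E].
Proof.
apply: (@four_growth_numbers_eq R P P_pos P_incr (fun _ w => Gamma_eps W T d eps w)).
- by move=> m _ w; exact: Gamma_eps_level.
- move=> _ w Ww; exists w; split=> // k; rewrite dist_shift_xx; exact: ltW.
- have [N HN] := exists_half_pow_le eps_gt0.
  exists N => n n0 Nn; have s0 (j : int) : (0 < level_size n)%N by rewrite expn_gt0.
  exists (coded_point R P n (fun=> 0%N)); first exact: Xlevel_X (coded_point_level R P n0 s0).
  move=> t c cn _; apply: coded_Gamma_eps => //; apply: le_trans HN.
  apply: (@le_trans _ _ (2 ^- N)); first exact: half_pow_anti.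
  by rewrite ler_peMl ?invr_ge0 ?exprn_ge0// ler1n.
Qed.

Lemma Dint_Dext_pre :
  [/\ Dint_pre_upper W T d eps = 1%E, Dint_pre_lower W T d eps = 1%E,
      Dext_pre_upper W T d eps = 0%E & Dext_pre_lower W T d eps = 0%E].
Proof.
apply: (@four_growth_numbers_eq R P P_pos P_incr
  (fun n w => preim_iter W T n (Gamma_eps W T d eps w))).
- move=> m n w Xw z [Wz] /=; rewrite iter_left_shift => /(Gamma_eps_level Xw).
  exact: Xlevel_shiftE.
(* The backward shift of [w] by [n] lands on [w] itself after [n] steps. *)
- move=> n w Ww; exists (shift_by (- Posz n) w); split; first exact: X_shift.
  rewrite /= iter_left_shift shift_byD subrr shift_by0; split=> // k.
  by rewrite dist_shift_xx ltW.
- have [N HN] := exists_half_pow_le eps_gt0.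
  exists N => n n0 Nn; have s0 (j : int) : (0 < level_size n)%N by rewrite expn_gt0.
  exists (coded_point R P n (fun=> 0%N)); first exact: Xlevel_X (coded_point_level R P n0 s0).
  move=> t c cn _; split; first exact: Xlevel_X (coded_point_level R P n0 cn).
  rewrite /= iter_left_shift shift_coded_point.
  apply: coded_Gamma_eps => //; apply: le_trans HN.
  apply: (@le_trans _ _ (2 ^- N)); first exact: half_pow_anti.
  by rewrite ler_peMl ?invr_ge0 ?exprn_ge0// ler1n.
Qed.

End Families.

Theorem proposition5p4 (R : realType) (P : nat -> nat) (eps : R)
  (P_pos : forall m : nat, (0 < m)%N -> (0 < P m)%N)
  (P_incr : forall m n : nat, (0 < m)%N -> (m < n)%N -> (P m < P n)%N)
  (eps_gt0 : 0 < eps) (eps_lt1 : eps < 1) :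
  [/\ Dint_upper (@X R P) (@left_shift R) (@dist_shift R) eps = 1%E,
      Dint_lower (@X R P) (@left_shift R) (@dist_shift R) eps = 1%E,
      Dext_upper (@X R P) (@left_shift R) (@dist_shift R) eps = 0%E &
      Dext_lower (@X R P) (@left_shift R) (@dist_shift R) eps = 0%E] /\
  [/\ Dint_pre_upper (@X R P) (@left_shift R) (@dist_shift R) eps = 1%E,
      Dint_pre_lower (@X R P) (@left_shift R) (@dist_shift R) eps = 1%E,
      Dext_pre_upper (@X R P) (@left_shift R) (@dist_shift R) eps = 0%E &
      Dext_pre_lower (@X R P) (@left_shift R) (@dist_shift R) eps = 0%E] /\
  [/\ Dint_as_upper (@X R P) (@left_shift R) (@dist_shift R) = 1%E,
      Dint_as_lower (@X R P) (@left_shift R) (@dist_shift R) = 1%E,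
      Dext_as_upper (@X R P) (@left_shift R) (@dist_shift R) = 0%E &
      Dext_as_lower (@X R P) (@left_shift R) (@dist_shift R) = 0%E].
Proof.
split; first exact: Dint_Dext_eps.
split; first exact: Dint_Dext_pre.
exact: Dint_Dext_as.
Qed.
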